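(* Let $X$ be a set, let $(R_x)_{x\in X}$ be a family of integral domains, and let $\Lambda=\prod_{x\in X}R_x$. For $x\in X$ let $\mathfrak{p}_x=\operatorname{Ker}(\pi_x)$, where $\pi_x:\Lambda\to R_x$ is the canonical projection; it is a minimal prime ideal of $\Lambda$. Then the space $\operatorname{Min}(\Lambda)$ together with the map $\eta:X\to\operatorname{Min}(\Lambda)$ given by $x\mapsto\mathfrak{p}_x$ is the Stone–Čech compactification of the discrete space $X$.
   Context: All rings are commutative with $1$. $\operatorname{Min}(R)$ denotes the set of minimal prime ideals of a ring $R$, equipped with the topology induced from the Zariski topology of $\operatorname{Spec}(R)$. A compact space means a quasi-compact Hausdorff space. The Stone–Čech compactification of a topological space $X$ is a pair $(\beta X,\eta)$ where $\beta X$ is a compact space and $\eta:X\to\beta X$ is a continuous map such that for each pair $(Y,\varphi)$ with $Y$ a compact space and $\varphi:X\to Y$ continuous, there is a unique continuous map $\widetilde\varphi:\beta X\to Y$ with $\varphi=\widetilde\varphi\circ\eta$. *)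

(* Defs.v *)
From HB Require Import structures.
From mathcomp Require Import all_boot all_algebra.
From mathcomp Require Import all_classical topology.

Set Implicit Arguments.
Unset Strict Implicit.
Unset Printing Implicit Defensive.

Import GRing.Theory.
Local Open Scope classical_set_scope.
Local Open Scope ring_scope.

(* The ideals of ring_quotient are boolean predicates on nontrivial rings.
   Here the zero ring has to be allowed: it is the product of the empty
   family, and its spectrum is empty. *)
Definition ideal (A : comPzRingType) (I : set A) : Prop :=
  [/\ I 0, forall a b, I a -> I b -> I (a + b) & forall a b, I b -> I (a * b)].

Definition prime_ideal (A : comPzRingType) (I : set A) : Prop :=
  [/\ ideal I, ~ I 1 & forall a b, I (a * b) -> I a \/ I b].

Definition Spec (A : comPzRingType) : Type :=
  set_type [set I : set A | prime_ideal I].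

HB.instance Definition _ (A : comPzRingType) := 
  Choice.copy (Spec A) (set_type [set I : set A | prime_ideal I]).

Lemma Spec_prime (A : comPzRingType) (p : Spec A) : prime_ideal (\val p).
Proof. exact: set_mem (valP p). Qed.

Section Zariski.
Variable A : comPzRingType.
Implicit Types (E F : set A) (U V : set (Spec A)).

Definition zero_locus E : set (Spec A) := [set p | E `<=` \val p].

Definition zariski_open U : Prop := exists E, U = ~` zero_locus E.

Fact zariski_openT : zariski_open setT.
Proof.
exists setT; apply/esym; rewrite -subTset => p _ pT.
by have [_ p1 _] := Spec_prime p; exact/p1/pT.
Qed.

Fact zariski_openI : setI_closed zariski_open.
Proof.
move=> _ _ [E ->] [F ->].
exists [set c | exists2 a, E a & exists2 b, F b & c = a * b].
rewrite -setCU; congr (~` _); apply/seteqP; split=> p /=.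
  have [[_ _ pM] _ _] := Spec_prime p.
  case=> pE _ [a Ea [b Fb ->]]; last by exact/pM/pE.
  by rewrite mulrC; exact/pM/pE.
have [_ _ pP] := Spec_prime p.
move=> pEF; apply: contrapT => /not_orP[/existsNP[a /not_implyP[Ea pa]]].
move=> /existsNP[b /not_implyP[Fb pb]].
by case: (pP a b) => //; apply: pEF; exists a => //; exists b.
Qed.

Fact zariski_open_bigU (J : Type) (f : J -> set (Spec A)) :
  (forall i, zariski_open (f i)) -> zariski_open (\bigcup_i f i).
Proof.
move=> /choice[E fE]; exists (\bigcup_i E i).
rewrite -[LHS]setCK; congr (~` _); rewrite setC_bigcup.
apply/seteqP; split=> p /=.
  by move=> pf a [i _ Eia]; have := pf i Logic.I; rewrite fE setCK; exact.
by move=> pE i _; rewrite fE setCK => a Eia; apply: pE; exists i.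
Qed.

HB.instance Definition _ := isOpenTopological.Build (Spec A)
  zariski_openT zariski_openI zariski_open_bigU.

End Zariski.

(* As a type, [Min A] carries the subspace topology from [Spec A], through the
   topology on [set_type]. *)
Definition Min (A : comPzRingType) : set (Spec A) :=
  [set p | forall q : Spec A, \val q `<=` \val p -> q = p].
Arguments Min A : clear implicits.

Definition prod_ring (X : Type) (R : X -> comPzRingType) : Type :=
  forall x, R x.

Section ProdRing.
Variables (X : Type) (R : X -> comPzRingType).
Local Notation L := (prod_ring R).
Implicit Types f g h : L.

HB.instance Definition _ := gen_eqMixin L.
HB.instance Definition _ := gen_choiceMixin L.

Definition prod_zero : L := fun=> 0.
Definition prod_one : L := fun=> 1.
Definition prod_opp f : L := fun x => - f x.
Definition prod_add f g : L := fun x => f x + g x.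
Definition prod_mul f g : L := fun x => f x * g x.

Fact prod_addA : associative prod_add.
Proof. by move=> f g h; apply: functional_extensionality_dep => x; exact: addrA. Qed.
Fact prod_addC : commutative prod_add.
Proof. by move=> f g; apply: functional_extensionality_dep => x; exact: addrC. Qed.
Fact prod_add0 : left_id prod_zero prod_add.
Proof. by move=> f; apply: functional_extensionality_dep => x; exact: add0r. Qed.
Fact prod_addN : left_inverse prod_zero prod_opp prod_add.
Proof. by move=> f; apply: functional_extensionality_dep => x; exact: addNr. Qed.
Fact prod_mulA : associative prod_mul.
Proof. by move=> f g h; apply: functional_extensionality_dep => x; exact: mulrA. Qed.
Fact prod_mulC : commutative prod_mul.
Proof. by move=> f g; apply: functional_extensionality_dep => x; exact: mulrC. Qed.
Fact prod_mul1 : left_id prod_one prod_mul.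
Proof. by move=> f; apply: functional_extensionality_dep => x; exact: mul1r. Qed.
Fact prod_mulr1 : right_id prod_one prod_mul.
Proof. by move=> f; apply: functional_extensionality_dep => x; exact: mulr1. Qed.
Fact prod_mulDl : left_distributive prod_mul prod_add.
Proof. by move=> f g h; apply: functional_extensionality_dep => x; exact: mulrDl. Qed.
Fact prod_mulDr : right_distributive prod_mul prod_add.
Proof. by move=> f g h; apply: functional_extensionality_dep => x; exact: mulrDr. Qed.

HB.instance Definition _ :=
  GRing.isZmodule.Build L prod_addA prod_addC prod_add0 prod_addN.
HB.instance Definition _ := GRing.Zmodule_isPzRing.Build L
  prod_mulA prod_mul1 prod_mulr1 prod_mulDl prod_mulDr.
HB.instance Definition _ := GRing.PzRing_hasCommutativeMul.Build L prod_mulC.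

Definition prod_proj (x : X) (f : L) : R x := f x.

Definition ker_proj (x : X) : set L := prod_proj x @^-1` [set 0].

End ProdRing.

Section MinimalPrime.
Variables (X : Type) (R : X -> idomainType).
Local Notation L := (prod_ring (fun x => R x)).

Lemma ker_proj_prime (x : X) : prime_ideal (ker_proj x : set L).
Proof.
split.
- split=> // f g; first change (f x = 0 -> g x = 0 -> f x + g x = 0).
    by move=> -> ->; rewrite addr0.
  change (g x = 0 -> f x * g x = 0).
  by move=> ->; rewrite mulr0.
- by change ((1 : R x) <> 0); apply/eqP; exact: oner_neq0.
move=> f g; change (f x * g x = 0 -> f x = 0 \/ g x = 0) => /eqP.
by rewrite mulf_eq0 => /orP[] /eqP; [left|right].
Qed.

Definition ker_proj_Spec (x : X) : Spec L :=
  exist _ (ker_proj x : set L) (mem_set (ker_proj_prime x)).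

Lemma ker_proj_minimal (x : X) : Min L (ker_proj_Spec x).
Proof.
move=> q qx; apply: val_inj; apply/seteqP; split=> // f fx.
change (f x = 0) in fx.
have [[q0 _ _] _ qP] := Spec_prime q.
pose e : L := fun y => (`[< y = x >])%:R.
have fe : f * e = 0.
  apply: functional_extensionality_dep => y.
  change (f y * (`[< y = x >])%:R = 0).
  by case: asboolP => [->|_]; rewrite ?mulr0 //= fx mul0r.
case: (qP f e) => //; first by rewrite fe.
move=> /qx; change (((`[< x = x >])%:R : R x) = 0 -> \val q f).
by rewrite asboolT // => /eqP; rewrite oner_eq0.
Qed.

Definition eta_Min (x : X) : Min L :=
  exist _ (ker_proj_Spec x) (mem_set (@ker_proj_minimal x)).

End MinimalPrime.
Arguments eta_Min {X} R x.

Definition compact_hausdorff (K : topologicalType) : Prop :=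
  compact [set: K] /\ hausdorff_space K.

Definition is_stone_cech (T K : topologicalType) (i : T -> K) : Prop :=
  [/\ compact_hausdorff K, continuous i &
      forall (Y : topologicalType) (phi : T -> Y),
        compact_hausdorff Y -> continuous phi ->
        exists! psi : K -> Y, continuous psi /\ phi = psi \o i].

(* Main.v *)
Require Import Defs.
From HB Require Import structures.
From mathcomp Require Import all_boot all_algebra.
From mathcomp Require Import all_classical topology.

(** A prime [p] of the product [L] decides, for each subset [S] of [X], which of
    the two orthogonal idempotents [1_S] and [1_(~S)] it contains; so the sets
    [S] with [1_S] outside [p] form an ultrafilter [U_p] on [X]
    ([prime_filter]).  Since [f] times the indicator of its zero set [Z(f)]
    vanishes, [Z(f)] in [U_p] forces [f] in [p].  Because the factors are
    domains, the [f] with [Z(f)] in [U_p] already form a prime ideal inside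
    [p]; hence [p] is minimal exactly when [f] in [p] is equivalent to [Z(f)] in
    [U_p] ([MinP]).  Minimal primes are thus the ultrafilters on [X], with [eta]
    giving the principal ones, and the argument follows the classical
    description of the Stone-Cech compactification by ultrafilters.

    Compactness ([Min_compact]): along an ultrafilter of minimal primes, the
    elements that eventually belong to them form a prime, minimal by [MinP],
    which is a limit.  Separation ([Min_hausdorff]): if [f] lies in [q] but not
    in [p], then the conditions that [Z(f)], or its complement, is in the
    ultrafilter define disjoint neighborhoods of [q] and [p].  Universality:
    a map [phi] from [X] to a compact space extends by sending [p] to a limit of
    the pushforward of [U_p] along [phi] ([eta_extension]), and the extension is
    unique because [eta] has dense range ([closure_eta]). *)

Set Implicit Arguments.
Unset Strict Implicit.
Unset Printing Implicit Defensive.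

Import GRing.Theory.
Local Open Scope classical_set_scope.
Local Open Scope ring_scope.

Definition Spec_of_prime (A : comPzRingType) (I : set A)
  (primeI : prime_ideal I) : Spec A := exist _ I (mem_set primeI).

Section MinimalSpectrum.
Variable A : comPzRingType.

(** A prime contained in [p] must contain [a], because it contains [a * b] and
    cannot contain [b]. *)
Lemma Min_of_annihilators (p : Spec A) :
  (forall a, \val p a -> exists2 b, ~ \val p b & a * b = 0) -> Min A p.
Proof.
move=> ann q qp; apply: val_inj; apply/seteqP; split=> // a /ann[b pb ab0].
have [[q0 _ _] _ qM] := Spec_prime q.
by have [||/qp] := qM a b; rewrite ?ab0.
Qed.

(** The sets of primes avoiding a single element form a base of the Zariski
    topology, because a zero locus is the intersection of the zero loci of
    single elements. *)
Lemma Min_nbhsP (p : Min A) (U : set (Min A)) :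
  nbhs p U <-> exists2 a, ~ \val (\val p) a &
    (forall q : Min A, ~ \val (\val q) a -> U q).
Proof.
split.
  rewrite nbhsE => -[_ [[V [E VE] <-] pV] VU].
  have : (~` zero_locus E) (\val p) by rewrite -VE; exact: pV.
  move=> /existsNP[a /not_implyP[Ea pa]]; exists a => // q qa.
  apply: VU; change (V (\val q)); rewrite VE => qE; exact/qa/qE.
case=> a pa aU; rewrite nbhsE.
exists [set q : Min A | ~ \val (\val q) a] => //; split=> //.
exists (~` zero_locus [set a]); first by exists [set a].
apply/seteqP; split=> q /= qa; first by move=> /= qa'; apply: qa => _ ->.
by move=> /(_ a erefl).
Qed.

End MinimalSpectrum.

Section PrimesOfProduct.
Variables (X : Type) (R : X -> idomainType).
Local Notation L := (prod_ring (fun x => R x)).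
Implicit Types (p : Spec L) (f g : L) (S T : set X).

Definition prod_indic S : L := fun x => (`[< S x >])%:R.

Definition zero_set f : set X := [set x | f x = 0].

Lemma prod_indicI S T : prod_indic (S `&` T) = prod_indic S * prod_indic T.
Proof.
apply: functional_extensionality_dep => x.
change ((`[< (S `&` T) x >])%:R = (`[< S x >])%:R * (`[< T x >])%:R :> R x).
by rewrite asbool_and -mulnb natrM.
Qed.

Lemma prod_indic0 : prod_indic set0 = 0.
Proof.
apply: functional_extensionality_dep => x.
by change ((`[< (set0 : set X) x >])%:R = 0 :> R x); rewrite asboolF.
Qed.

Lemma prod_indicT : prod_indic setT = 1.
Proof.
apply: functional_extensionality_dep => x.
by change ((`[< (setT : set X) x >])%:R = 1 :> R x); rewrite asboolT.
Qed.

Lemma prod_indicDC S : prod_indic S + prod_indic (~` S) = 1.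
Proof.
apply: functional_extensionality_dep => x.
change ((`[< S x >])%:R + (`[< ~ S x >])%:R = 1 :> R x).
by rewrite asbool_neg; case: asboolP; rewrite ?addr0 ?add0r.
Qed.

Lemma mul_indic_zero_set f : f * prod_indic (zero_set f) = 0.
Proof.
apply: functional_extensionality_dep => x.
change (f x * (`[< f x = 0 >])%:R = 0).
by case: asboolP => [->|_]; rewrite ?mul0r ?mulr0.
Qed.

(** The ultrafilter [U_p] on [X] attached to the prime [p]; it is encoded with
    non-membership, so that [prime_filter] of an indicator is literally a basic
    open condition on [p]. *)
Definition prime_filter p : set_system X := [set S | ~ \val p (prod_indic S)].

Instance prime_filter_proper p : ProperFilter (prime_filter p).
Proof.
have [[p0 pD pMl] p1 pM] := Spec_prime p.
apply: Build_ProperFilter_ex => [S pS|].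
  apply: contrapT => /set0P/negP; rewrite negbK => /eqP S0.
  by apply: pS; rewrite S0 prod_indic0.
split=> [|S T pS pT|S T ST pS].
- by rewrite /prime_filter /= prod_indicT.
- by rewrite /prime_filter /= prod_indicI => /pM[].
- by move=> pT; apply: pS; rewrite -(setIidl ST) prod_indicI; exact: pMl.
Qed.

Lemma prime_filterVC p S : prime_filter p S \/ prime_filter p (~` S).
Proof.
have [[_ pD _] p1 _] := Spec_prime p.
have [|pS] := pselect (prime_filter p S); [by left|right=> pSC].
by apply: p1; rewrite -(prod_indicDC S); apply: pD => //; exact: contrapT.
Qed.

Lemma prime_filter_zero_set p f : prime_filter p (zero_set f) -> \val p f.
Proof.
have [[p0 _ _] _ pM] := Spec_prime p.
by case: (pM f (prod_indic (zero_set f))); rewrite ?mul_indic_zero_set.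
Qed.

(** This is the minimal prime below [p].  The factors being domains, [Z(f * g)]
    is the union of [Z(f)] and [Z(g)], and an ultrafilter that contains a union
    contains one of its two members. *)
Lemma prime_of_prime_filter p :
  prime_ideal [set f | prime_filter p (zero_set f)].
Proof.
split.
- split=> [|f g fp gp|f g].
  + by rewrite /=; apply: filterE.
  + apply: filterS (filterI fp gp) => x [fx gx].
    by change (f x + g x = 0); rewrite fx gx addr0.
  + by apply: filterS => x gx; change (f x * g x = 0); rewrite gx mulr0.
- move=> /filter_ex[x]; change ((1 : R x) = 0 -> False).
  by move=> /eqP; rewrite oner_eq0.
move=> f g fgp.
have [|fp] := prime_filterVC p (zero_set f); [by left|right].
apply: filterS (filterI fgp fp) => x [].
change (f x * g x = 0 -> f x <> 0 -> g x = 0).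
by move=> /eqP; rewrite mulf_eq0 => /orP[] /eqP.
Qed.

(** From left to right, [p] coincides with the prime of
    [prime_of_prime_filter]; from right to left, the indicator of [Z(f)]
    annihilates [f] and lies outside [p]. *)
Lemma MinP p : Min L p <-> forall f, \val p f -> prime_filter p (zero_set f).
Proof.
split=> [minp f pf|pz]; last first.
  apply: Min_of_annihilators => f /pz pf.
  by exists (prod_indic (zero_set f)) => //; exact: mul_indic_zero_set.
pose q : Spec L := Spec_of_prime (prime_of_prime_filter p).
have qp : q = p by apply: minp => g; exact: prime_filter_zero_set.
by move: pf; rewrite -{1}qp.
Qed.

End PrimesOfProduct.
#[local] Existing Instance prime_filter_proper.

(** The quotient by this ideal embeds in the ultraproduct of the domains
    [A / p_i]. *)
Lemma ultra_limit_prime (A : comPzRingType) (I : Type) (F : set_system I)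
    (p : I -> Spec A) : UltraFilter F ->
  prime_ideal [set a | F [set i | \val (p i) a]].
Proof.
move=> FU; have FF := @ultra_proper _ _ FU; split.
- split=> [|a b Fa Fb|a b].
  + by apply: filterE => i; have [[]] := Spec_prime (p i).
  + apply: filterS (filterI Fa Fb) => i [].
    by have [[_ pD _] _ _] := Spec_prime (p i); exact: pD.
  + by apply: filterS => i; have [[_ _ pM] _ _] := Spec_prime (p i); exact: pM.
- by move=> /filter_ex[i]; have [_] := Spec_prime (p i).
move=> a b Fab.
have [|Fa] := in_ultra_setVsetC [set i | \val (p i) a] FU; [by left|right].
apply: filterS (filterI Fab Fa) => i [] /=.
by have [_ _ pM] := Spec_prime (p i) => /pM[].
Qed.

Lemma eq_on_closure (T Y : topologicalType) (D : set T) (f g : T -> Y) :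
    hausdorff_space Y -> continuous f -> continuous g ->
    (forall x, D x -> f x = g x) ->
  forall x, closure D x -> f x = g x.
Proof.
move=> hY fC gC fg x Dx; apply: hY => A B fA gB.
have fgAB : nbhs x (f @^-1` A `&` g @^-1` B).
  by apply: filterI; [exact: fC|exact: gC].
have [y [Dy [Ay By]]] := Dx _ fgAB.
by exists (f y); split=> //; rewrite fg.
Qed.

Section MinimalSpectrumOfProduct.
Variables (X : Type) (R : X -> idomainType).
Local Notation L := (prod_ring (fun x => R x)).
Implicit Types p q : Min L.

Lemma nbhs_Min_prime_filter p S : prime_filter (\val p) S ->
  nbhs p [set q | prime_filter (\val q) S].
Proof. by move=> pS; apply/Min_nbhsP; exists (prod_indic R S). Qed.

(** Minimality passes to the limit prime [m]: if both [f] and the indicator of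
    [Z(f)] were in [m], they would belong together to one of the minimal primes,
    against [MinP]. *)
Lemma Min_compact : compact [set: Min L].
Proof.
rewrite compact_ultra => F FU _; have FF := @ultra_proper _ _ FU.
pose m : Spec L :=
  Spec_of_prime (ultra_limit_prime (fun p : Min L => \val p) FU).
have mM : Min L m.
  apply/MinP => f Ff /(filterI Ff)/filter_ex[p [pf pZ]].
  by have /MinP/(_ _ pf) := set_mem (valP p); apply.
exists (exist _ m (mem_set mM) : Min L); split=> // U /Min_nbhsP[f mf fU].
have [//|Ff] := in_ultra_setVsetC [set p : Min L | \val (\val p) f] FU.
by apply: filterS Ff => p; exact: fU.
Qed.

Lemma Min_hausdorff : hausdorff_space (Min L).
Proof.
move=> p q pq; apply: contrapT => npq.
(* If no such [f] existed, [q] would be included in [p], and minimality of [p]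
   would make them equal. *)
have [f [qf pf]] : exists f, \val (\val q) f /\ ~ \val (\val p) f.
  apply: contrapT => /forallNP qp; apply: npq; apply: val_inj; apply: esym.
  have := set_mem (valP p); apply => f qf.
  by apply: contrapT => pf; apply: (qp f).
have qZ : prime_filter (\val q) (zero_set f).
  by have /MinP := set_mem (valP q); exact.
have pZ : prime_filter (\val p) (~` zero_set f).
  by have [/prime_filter_zero_set|] := prime_filterVC (\val p) (zero_set f).
have [r [rZC rZ]] :=
  pq _ _ (nbhs_Min_prime_filter pZ) (nbhs_Min_prime_filter qZ).
have /filter_ex[x [] //] :
  prime_filter (\val r) (~` zero_set f `&` zero_set f).
exact: (@filterI _ (prime_filter (\val r)) _ _ _ rZC rZ).
Qed.

Lemma prime_filter_eta x S : prime_filter (\val (eta_Min R x)) S <-> S x.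
Proof.
change ((`[< S x >])%:R <> 0 :> R x <-> S x).
by case: asboolP => Sx; split=> // _; apply/eqP; rewrite oner_neq0.
Qed.

(** A basic open set is given by some [f] outside a prime, hence nonzero, and
    [f] is outside the kernel of any projection at which it does not vanish. *)
Lemma closure_eta p : closure (range (eta_Min R)) p.
Proof.
move=> U /Min_nbhsP[f pf fU].
have [x fx] : exists x, f x <> 0.
  apply: contrapT => /forallNP f0; apply: pf.
  suff -> : f = 0 by have [[]] := Spec_prime (\val p).
  by apply: functional_extensionality_dep => x; exact: contrapT.
by exists (eta_Min R x); split; [exists x|exact: fU].
Qed.

(** The value at [p] is chosen as a cluster point of the pushforward of the
    ultrafilter of [p], so that it lies in the closure of every [B] whose
    preimage is in that ultrafilter.  Continuity then follows from the
    regularity of [Y]: the condition that the preimage of [B] is in the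
    ultrafilter is open in [p]. *)
Lemma eta_extension (Y : topologicalType) (phi : X -> Y) :
  compact_hausdorff Y ->
  exists2 psi : Min L -> Y, continuous psi & phi = psi \o eta_Min R.
Proof.
move=> [cY hY].
have /choice[psi psiP] (p : Min L) :
    exists y : Y, cluster (phi @ prime_filter (\val p)) y.
  have [|y [_ ?]] := cY (phi @ prime_filter (\val p)) _ _; last by exists y.
  exact: filterT.
have psi_closure p (B : set Y) :
    prime_filter (\val p) (phi @^-1` B) -> closure B (psi p).
  by move=> pB C; exact: psiP.
exists psi => [p U /(compact_regular hY cY filterT)[B pB BU]|].
  have pS : prime_filter (\val p) (phi @^-1` B).
    (* Otherwise [psi p] would be in the closure of the complement of [B]. *)
  have [//|/(psi_closure _ (~` B))/(_ _ pB)[y []//]] :=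
      prime_filterVC (\val p) (phi @^-1` B).
  by apply: filterS (nbhs_Min_prime_filter pS) => q /psi_closure /BU.
apply: funext => x; apply: hY => A B xA xB /=.
have [|y [-> By]] := psi_closure (eta_Min R x) [set phi x] _ B xB.
  exact/prime_filter_eta.
by exists (phi x); split=> //; exact: nbhs_singleton.
Qed.

End MinimalSpectrumOfProduct.

(* [{classic X}] is [X] itself with the choice structure that topological types
   require. *)
Theorem theorem3p5 (X : Type) (R : X -> idomainType) :
  @is_stone_cech (discrete_topology {classic X})
    (Min (prod_ring (fun x => R x))) (eta_Min R).
Proof.
split.
- by split; [exact: Min_compact|exact: Min_hausdorff].
- by move=> x U /nbhs_singleton xU; exact/principal_filterP.
move=> Y phi YK _; have [psi psiC phiE] := eta_extension R phi YK.
exists psi; split=> // psi' [psi'C phiE']; apply: funext => p.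
have agree : forall q, range (eta_Min R) q -> psi q = psi' q.
  by move=> _ [x _ <-]; have := congr1 (fun h => h x) phiE'; rewrite phiE.
exact: (eq_on_closure YK.2 psiC psi'C agree (@closure_eta _ _ p)).
Qed.
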